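(* Let $\Gamma=(X,R)$ be a bipartite distance-regular graph with even diameter $D\ge 4$ and valency $k\ge 3$, let $d=D/2$, and fix a vertex $x\in X$ with associated subconstituent algebra $T=T(x)$. Let $W$ be a thin irreducible $T$-module with endpoint $2$ and local eigenvalue $\tilde\theta_d$, and let $v$ be a nonzero vector in $E^*_2W$. Then $W=Mv$, the vectors $E_iv$ $(1\le i\le D-1,\ i\neq d)$ form a basis for $W$, and $E_0v=0$, $E_dv=0$, $E_Dv=0$.
   Context: $\Gamma=(X,R)$ is a finite connected graph with path-length distance $\partial$; it is distance-regular with intersection numbers $p^h_{ij}$, $c_i=p^i_{1,i-1}$, $b_i=p^i_{1,i+1}$ (with $c_0=0$, $b_D=0$), and bipartite (so $c_i+b_i=k$). For $0\le i\le D$, $A_i$ is the $i$-th distance matrix ($(A_i)_{yz}=1$ if $\partial(y,z)=i$, else $0$), $A=A_1$, and $M$ is the Bose–Mesner algebra (the span of $A_0,\dots,A_D$, equivalently the algebra generated by $A$). $\theta_0=k>\theta_1>\dots>\theta_D$ are the distinct eigenvalues of $A$ and $E_i$ is the primitive idempotent of $A$ for $\theta_i$. $V=\mathbb{C}^X$ is the standard module. For the fixed vertex $x$, $E^*_i$ is the diagonal matrix in $\mathrm{Mat}_X(\mathbb{C})$ whose $(y,y)$-entry is $1$ if $\partial(x,y)=i$ and $0$ otherwise; $T$ is the subalgebra of $\mathrm{Mat}_X(\mathbb{C})$ generated by $A,E^*_0,\dots,E^*_D$. A $T$-module is a subspace $W\subseteq V$ with $BW\subseteq W$ for all $B\in T$;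 it is irreducible if nonzero and containing no $T$-modules other than $0$ and $W$; thin if $\dim E^*_iW\le 1$ for all $i$; its endpoint is $\min\{i: E^*_iW\ne 0\}$. For a thin irreducible $T$-module $W$ with endpoint $2$, $E^*_2W$ is a one-dimensional eigenspace of $E^*_2A_2E^*_2$; the corresponding eigenvalue is the local eigenvalue of $W$. Here $\tilde\theta_d=-1-b_2b_3(\theta_d^2-b_2)^{-1}$. *)

(* Defs.v *)
From HB Require Import structures.
From mathcomp Require Import all_boot all_order all_algebra.
From mathcomp Require Import reals.
From mathcomp.real_closed Require Import complex.

Set Implicit Arguments.
Unset Strict Implicit.
Unset Printing Implicit Defensive.

Import Order.TTheory GRing.Theory Num.Theory.
Local Open Scope ring_scope.

(* A finite simple graph is a symmetric irreflexive relation e on a finType X. *)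

Definition walk (X : finType) (e : rel X) (n : nat) (y z : X) : bool :=
  [exists s : n.-tuple X, path e y s && (last y s == z)].

(* The least length of a walk from y to z. In a connected graph it is at most
   #|X| - 1; the value is #|X| when y and z are not connected. *)
Definition dist (X : finType) (e : rel X) (y z : X) : nat :=
  find (fun n => walk e n y z) (iota 0 #|X|).

Definition diameter (X : finType) (e : rel X) : nat :=
  \max_(yz : X * X) dist e yz.1 yz.2.

Definition connected_graph (X : finType) (e : rel X) : Prop :=
  forall y z, connect e y z.

Definition bipartite (X : finType) (e : rel X) : Prop :=
  exists f : X -> bool, forall y z, e y z -> f y != f z.

Definition valency (X : finType) (e : rel X) (k : nat) : Prop :=
  forall y, #|[set z | e y z]| = k.

(* p h i j is the intersection number p^h_{ij}. No bound on i and j is needed: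
   the count is 0 when i or j exceeds the diameter. In particular b_D = 0. *)
Definition distance_regular (X : finType) (e : rel X)
    (p : nat -> nat -> nat -> nat) : Prop :=
  forall (h i j : nat) (y z : X), dist e y z = h ->
    #|[set w | (dist e y w == i) && (dist e w z == j)]| = p h i j.

Definition b_ (p : nat -> nat -> nat -> nat) (i : nat) : nat := p i 1%N i.+1.

(* Mat_X(F) and F^X are 'M[F]_#|X| and 'cV[F]_#|X|, with X indexed by
   enum_val; matrices act on column vectors from the left. *)

Definition distance_mx (F : fieldType) (X : finType) (e : rel X) (i : nat) :
    'M[F]_#|X| :=
  \matrix_(s, t) (dist e (enum_val s) (enum_val t) == i)%:R.

Definition adjacency_mx (F : fieldType) (X : finType) (e : rel X) :
    'M[F]_#|X| := distance_mx F e 1.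

Definition bose_mesner (F : fieldType) (X : finType) (e : rel X) :
    {vspace 'M[F]_#|X|} :=
  <<[seq distance_mx F e i | i <- iota 0 (diameter e).+1]>>%VS.

(* theta_0 > ... > theta_D are the distinct eigenvalues of A in F, where the
   real numbers are embedded in F by emb. *)
Definition ordered_eigenvalues (R : realType) (F : fieldType) (emb : R -> F)
    (n : nat) (A : 'M[F]_n) (D : nat) (theta : nat -> R) : Prop :=
  (forall i j : nat, (i < j <= D)%N -> theta j < theta i) /\
  (forall a : F, eigenvalue A a <-> exists2 i, (i <= D)%N & a = emb (theta i)).

Definition primitive_idempotent (F : fieldType) (n : nat)
    (M : {vspace 'M[F]_n}) (E : 'M[F]_n) : Prop :=
  [/\ E \in M, E != 0, E *m E = E &
      forall P Q : 'M[F]_n, P \in M -> Q \in M ->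
        P *m P = P -> Q *m Q = Q -> P *m Q = 0 -> Q *m P = 0 ->
        E = P + Q -> P = 0 \/ Q = 0].

(* An eigenvalue a of A determines E: the Bose-Mesner algebra is spanned by the
   projections onto the eigenspaces of A. *)
Definition primitive_idempotent_for (F : fieldType) (X : finType) (e : rel X)
    (a : F) (E : 'M[F]_#|X|) : Prop :=
  primitive_idempotent (bose_mesner F e) E /\ adjacency_mx F e *m E = a *: E.

Definition dual_idempotent (F : fieldType) (X : finType) (e : rel X) (x : X)
    (i : nat) : 'M[F]_#|X| :=
  diag_mx (\row_s (dist e x (enum_val s) == i)%:R).

Inductive generated_algebra (F : fieldType) (n : nat) (S : seq 'M[F]_n) :
    'M[F]_n -> Prop :=
| GenIn B : B \in S -> generated_algebra S B
| GenOne : generated_algebra S 1%:M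
| GenScale a B : generated_algebra S B -> generated_algebra S (a *: B)
| GenAdd B C : generated_algebra S B -> generated_algebra S C ->
    generated_algebra S (B + C)
| GenMul B C : generated_algebra S B -> generated_algebra S C ->
    generated_algebra S (B *m C).

Definition subconstituent_algebra (F : fieldType) (X : finType) (e : rel X)
    (x : X) : 'M[F]_#|X| -> Prop :=
  generated_algebra (adjacency_mx F e ::
    [seq dual_idempotent F e x i | i <- iota 0 (diameter e).+1]).

Definition T_module (F : fieldType) (X : finType) (e : rel X) (x : X)
    (W : {vspace 'cV[F]_#|X|}) : Prop :=
  forall B, subconstituent_algebra e x B -> forall w, w \in W -> B *m w \in W.

Definition irreducible_T_module (F : fieldType) (X : finType) (e : rel X)
    (x : X) (W : {vspace 'cV[F]_#|X|}) : Prop :=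
  [/\ T_module e x W, W != 0%VS &
      forall U : {vspace 'cV[F]_#|X|},
        T_module e x U -> (U <= W)%VS -> U = 0%VS \/ U = W].

Definition mx_image (F : fieldType) (n : nat) (B : 'M[F]_n)
    (W : {vspace 'cV[F]_n}) : {vspace 'cV[F]_n} :=
  (linfun (mulmx B : 'cV[F]_n -> 'cV[F]_n) @: W)%VS.

Definition mx_orbit (F : fieldType) (n : nat) (M : {vspace 'M[F]_n})
    (v : 'cV[F]_n) : {vspace 'cV[F]_n} :=
  (linfun (mulmxr v : 'M[F]_n -> 'cV[F]_n) @: M)%VS.

Definition thin (F : fieldType) (X : finType) (e : rel X) (x : X)
    (W : {vspace 'cV[F]_#|X|}) : Prop :=
  forall i, (i <= diameter e)%N ->
    (\dim (mx_image (dual_idempotent F e x i) W) <= 1)%N.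

(* min {i : E*_i W <> 0}, with value D + 1 for W = 0. *)
Definition endpoint (F : fieldType) (X : finType) (e : rel X) (x : X)
    (W : {vspace 'cV[F]_#|X|}) : nat :=
  find (fun i => mx_image (dual_idempotent F e x i) W != 0%VS)
    (iota 0 (diameter e).+1).

(* For W thin with endpoint 2, E*_2 W is spanned by a nonzero vector, so there
   is only one such eta. *)
Definition local_eigenvalue (F : fieldType) (X : finType) (e : rel X) (x : X)
    (W : {vspace 'cV[F]_#|X|}) (eta : F) : Prop :=
  let E2 := dual_idempotent F e x 2 in
  forall u, u \in mx_image E2 W -> (E2 *m distance_mx F e 2 *m E2) *m u = eta *: u.

(* Main.v *)
(* Since [Gamma] is bipartite, [theta_(D-i) = - theta_i]; so [theta_d = 0] and
   the local eigenvalue is [b_3 - 1]. The vertices at distance 2 from [x] are at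
   distances 0, 2, 4 from one another, and the entries of [v] sum to 0; hence, if
   [E] is the idempotent of [theta], with entry [g_i] at distance [i], then
   [E*_2 E v = l v] with [l = g_0 - g_4 + (b_3 - 1) (g_2 - g_4)]. The three-term
   recurrence for the [g_i] gives
   [b_2 k (k - 1) l = theta^2 (k^2 - theta^2) g_0] with [g_0 > 0]. As [E] is
   Hermitian, [|E v|^2 = l |v|^2], so [E v = 0] exactly for [theta = 0, k, -k].
   That [W = M v] holds for every thin irreducible module, [v] spanning its first
   nonzero level. *)

Require Import Defs.
From HB Require Import structures.
From mathcomp Require Import all_boot all_order all_algebra.
From mathcomp Require Import reals.
From mathcomp.real_closed Require Import complex.
From mathcomp Require Import zify ring.
Import Order.TTheory GRing.Theory Num.Theory.
Local Open Scope ring_scope.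

Set Implicit Arguments.
Unset Strict Implicit.
Unset Printing Implicit Defensive.

(** * Distance in a bipartite graph *)

Section GraphDistance.
Variables (X : finType) (e : rel X).
Implicit Types (x y z w : X).

Lemma walkP n y z :
  reflect (exists s, [/\ size s = n, path e y s & last y s = z])
          (walk e n y z).
Proof.
apply: (iffP existsP) => [[s /andP[pth /eqP lst]] | [s [sz pth lst]]].
  by exists s; rewrite size_tuple.
have szP : size s == n by rewrite sz.
by exists (Tuple szP); rewrite /= pth lst eqxx.
Qed.

Lemma dist_le_walk y z n : walk e n y z -> (dist e y z <= n)%N.
Proof.
move=> wn; rewrite leqNgt; apply/negP => lt_n.
have szn : (n < #|X|)%N.
  by apply: leq_trans lt_n _; rewrite -[leqRHS](size_iota 0) find_size.
by have := before_find 0 lt_n; rewrite nth_iota // add0n wn.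
Qed.

Lemma dist_refl y : dist e y y = 0%N.
Proof.
by apply/eqP; rewrite -leqn0; apply/dist_le_walk/walkP; exists [::].
Qed.

Hypothesis conn : connected_graph e.

(** A path shortened to distinct vertices has at most [#|X|] of them, so the bounded search in
    [dist] succeeds. *)
Lemma walk_dist y z : walk e (dist e y z) y z.
Proof.
have ex_walk : has (fun n => walk e n y z) (iota 0 #|X|).
  have /connectP[s pth ->] := conn y z.
  case/shortenP: pth => s' pth uniq_s' _.
  apply/hasP; exists (size s'); last by apply/walkP; exists s'.
  by have := max_card (mem (y :: s')); rewrite (card_uniqP uniq_s') mem_iota.
have := nth_find 0 ex_walk; rewrite nth_iota ?add0n //.
by rewrite has_find size_iota in ex_walk.
Qed.

Lemma dist_eq0 y z : (dist e y z == 0)%N = (y == z).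
Proof.
apply/eqP/eqP => [d0 | ->]; last exact: dist_refl.
by have := walk_dist y z; rewrite d0 => /walkP[s [/size0nil -> _ /=]].
Qed.

Lemma dist_edge_le y w z : e y w -> (dist e y z <= (dist e w z).+1)%N.
Proof.
move=> eyw; have /walkP[s [sz pth lst]] := walk_dist w z.
apply/dist_le_walk/walkP; exists (w :: s); split=> //=; first by rewrite sz.
by rewrite eyw.
Qed.

Lemma dist_succ_nbr y z n : dist e y z = n.+1 ->
  exists2 w, e y w & dist e w z = n.
Proof.
move=> dyz; have := walk_dist y z.
rewrite dyz => /walkP[[|w s] [//= [sz] /andP[eyw pth] lst]].
exists w => //; apply/eqP; rewrite eqn_leq; apply/andP; split.
  by apply/dist_le_walk/walkP; exists s.
by rewrite -ltnS -dyz; apply: dist_edge_le.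
Qed.

Lemma dist_triangle y w z : (dist e y z <= dist e y w + dist e w z)%N.
Proof.
move dn : (dist e y w) => n; elim: n y dn => [|n IHn] y dn.
  by move/eqP: dn; rewrite dist_eq0 => /eqP->.
have [y' eyy' /IHn le_n] := dist_succ_nbr dn.
by apply: leq_trans (dist_edge_le _ eyy') _; rewrite addSn ltnS.
Qed.

Lemma dist_le_diameter y z : (dist e y z <= diameter e)%N.
Proof. exact: (leq_bigmax (y, z)). Qed.

(** The diameter is attained by some pair, since the argument of type [X] makes the maximum range
    over a nonempty set; moving along a geodesic then lowers the distance by one at a time. *)
Lemma exists_dist j : X -> (j <= diameter e)%N ->
  exists yz, dist e yz.1 yz.2 = j.
Proof.
move=> x0; have [[y z] dyz] : exists yz, dist e yz.1 yz.2 = diameter e.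
  rewrite /diameter.
  have [|yz ->] := @bigop.eq_bigmax _ (fun yz => dist e yz.1 yz.2).
    by rewrite -(cardsE predT) cardsT; apply/card_gt0P; exists (x0, x0).
  by exists yz.
elim: (diameter e) y dyz => [|D IHD] y dyz; rewrite leq_eqVlt => /predU1P[->|].
- by exists (y, z).
- by [].
- by exists (y, z).
by have [w _ dwz] := dist_succ_nbr dyz; apply: IHD dwz.
Qed.

Hypothesis esym : symmetric e.

Lemma dist_sym y z : dist e y z = dist e z y.
Proof.
suff le_dist u t : (dist e u t <= dist e t u)%N.
  by apply/eqP; rewrite eqn_leq !le_dist.
have /walkP[s [<- pth lst]] := walk_dist t u.
apply/dist_le_walk/walkP; exists (rev (belast t s)); split.
- by rewrite size_rev size_belast.
- by rewrite -lst rev_path (eq_path (e' := e)) // => a b; rewrite esym.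
by case: s {pth} lst => [|b s] /= lst; rewrite ?rev_cons ?last_rcons.
Qed.

Hypothesis eirr : irreflexive e.

Lemma dist_eq1 y z : (dist e y z == 1)%N = e y z.
Proof.
apply/eqP/idP => [/dist_succ_nbr[w eyw /eqP] | eyz].
  by rewrite dist_eq0 => /eqP <-.
apply/eqP; rewrite eqn_leq; apply/andP; split.
  by have := dist_edge_le z eyz; rewrite dist_refl.
by rewrite lt0n dist_eq0; apply: contraL eyz => /eqP->; rewrite eirr.
Qed.

Section Bipartition.
Variable f : X -> bool.
Hypothesis f_edge : forall y z, e y z -> f y != f z.

Lemma odd_dist y z : odd (dist e y z) = (f y != f z).
Proof.
move dn : (dist e y z) => n; elim: n y dn => [|n IHn] y dn.
  by move/eqP: dn; rewrite dist_eq0 => /eqP->; rewrite eqxx.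
have [w /f_edge fyw /IHn /= ->] := dist_succ_nbr dn.
by case: (f y) (f w) (f z) fyw => [] [] [].
Qed.

(** The triangle inequality allows a change of at most one, and parity excludes no change. *)
Lemma dist_edge_bip y w z : e y w ->
  (dist e w z == (dist e y z).-1) || (dist e w z == (dist e y z).+1).
Proof.
move=> eyw; have ewy : e w y by rewrite esym.
have le1 := dist_edge_le z eyw; have le2 := dist_edge_le z ewy.
have: odd (dist e y z) != odd (dist e w z).
  by rewrite !odd_dist; move: (f_edge eyw); case: (f y) (f w) (f z) => [] [] [].
by move: le1 le2; lia.
Qed.

End Bipartition.
End GraphDistance.

(** * The Bose-Mesner algebra *)

Section IntersectionNumbers.
Variables (X : finType) (e : rel X) (p : nat -> nat -> nat -> nat).
Variable (f : X -> bool).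
Hypotheses (esym : symmetric e) (eirr : irreflexive e).
Hypotheses (conn : connected_graph e) (drg : distance_regular e p).
Hypothesis f_edge : forall y z, e y z -> f y != f z.
Implicit Types (x y z w : X).

Local Notation D := (diameter e).
Local Notation c_ h := (p h 1 h.-1).
Local Notation b_ := (b_ p).

Lemma card_nbr_dist y z j :
  #|[set w | e y w & dist e w z == j]| = p (dist e y z) 1 j.
Proof.
by rewrite -(drg _ _ (erefl _)); apply: eq_card => w; rewrite !inE dist_eq1.
Qed.

(** Source of both [c_ h + b_ h = k] and the three-term recurrence. Bipartiteness excludes a term at
    distance [h]. *)
Lemma sum_nbr (V : nmodType) (F : nat -> V) y z : let h := dist e y z in
  \sum_(w | e y w) F (dist e w z) = F h.-1 *+ c_ h + F h.+1 *+ b_ h.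
Proof.
move=> h; rewrite (bigID (fun w => dist e w z == h.-1)) /=; congr (_ + _).
  rewrite (eq_bigr (fun=> F h.-1)) => [|w /andP[_ /eqP->] //].
  by rewrite -card_nbr_dist cardsE sumr_const.
rewrite (eq_bigl (fun w => e y w && (dist e w z == h.+1))) => [|w]; last first.
  have [eyw|//] := boolP (e y w); rewrite /=.
  by move: (dist_edge_bip conn esym f_edge z eyw); rewrite -/h; lia.
rewrite (eq_bigr (fun=> F h.+1)) => [|w /andP[_ /eqP->] //].
by rewrite /Defs.b_ -card_nbr_dist cardsE sumr_const.
Qed.

Section Values.
Variables (k : nat) (x : X).
Hypothesis val_k : valency e k.

(** As [0.-1 = 0], this counts the neighbours of a vertex that coincide with it. *)
Lemma c0_eq0 : c_ 0 = 0%N.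
Proof.
have := card_nbr_dist x x 0; rewrite dist_refl /= => <-.
apply/eqP; rewrite cards_eq0; apply/eqP/setP => w; rewrite !inE dist_eq0 //.
by case: eqP => [->|]; rewrite ?eirr ?andbF.
Qed.

Lemma c_add_b h : (h <= D)%N -> (c_ h + b_ h)%N = k.
Proof.
move=> /(exists_dist conn x)[[y z] /= dyz].
have := sum_nbr (fun=> 1%N) y z; rewrite dyz /=.
have natnE n : 1%N *+ n = n by rewrite -[LHS]/(n%:R) natn.
rewrite !natnE => cb; apply: etrans (Logic.eq_sym cb) _.
rewrite -(val_k y) -sum1_card big_mkcond [RHS]big_mkcond /=.
by apply: eq_bigr => w _; rewrite inE.
Qed.

Lemma b0_eq : b_ 0 = k.
Proof. by rewrite -(@c_add_b 0) // c0_eq0. Qed.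

Lemma c1_eq1 : (0 < D)%N -> c_ 1 = 1%N.
Proof.
move=> /(exists_dist conn x)[[y z] /= dyz].
have := card_nbr_dist y z 0; rewrite dyz /= => <-.
rewrite -[RHS](cards1 z); apply: eq_card => w.
rewrite !inE dist_eq0 //; case: eqP => [->|]; rewrite ?andbF // andbT.
by rewrite -dist_eq1 // dyz.
Qed.

Lemma c_gt0 h : (0 < h <= D)%N -> (0 < c_ h)%N.
Proof.
case: h => // h /(exists_dist conn x)[[y z] /= dyz].
have [w eyw dwz] := dist_succ_nbr conn dyz.
rewrite -dyz -card_nbr_dist; apply/card_gt0P; exists w.
by rewrite inE eyw dwz /=.
Qed.

Lemma b_gt0 h : (h < D)%N -> (0 < b_ h)%N.
Proof.
move=> /(exists_dist conn x)[[y z] /= dyz].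
(* The geodesic step is reversed: [y] is a neighbour of [w] farther from [z]. *)
have [w eyw dwz] := dist_succ_nbr conn dyz.
rewrite /Defs.b_ -dwz -card_nbr_dist; apply/card_gt0P; exists y.
by rewrite inE esym eyw dyz dwz /=.
Qed.

End Values.

Section BoseMesner.
Variable F : fieldType.

Local Notation M := (bose_mesner F e).
Local Notation A := (adjacency_mx F e).

(** The general element of the Bose-Mesner algebra, given by its entry at each distance instead of
    by coordinates in a span. *)
Definition dist_fun_mx (c : nat -> F) : 'M[F]_#|X| :=
  \matrix_(s, t) c (dist e (enum_val s) (enum_val t)).

Lemma dist_fun_mx_sum c :
  dist_fun_mx c = \sum_(j < D.+1) c j *: distance_mx F e j.
Proof.
apply/matrixP => s t; rewrite summxE !mxE.
set h := dist _ _ _; have lt_h : (h < D.+1)%N by apply: dist_le_diameter.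
rewrite (bigD1 (Ordinal lt_h)) //= big1 => [|j ne_j].
  by rewrite !mxE eqxx mulr1 addr0.
rewrite !mxE -/h eq_sym; move: ne_j; rewrite -val_eqE /= => /negbTE->.
by rewrite mulr0.
Qed.

Lemma bose_mesnerP (B : 'M[F]_#|X|) :
  reflect (exists c, B = dist_fun_mx c) (B \in M).
Proof.
apply: (iffP idP) => [BM | [c ->]]; last first.
  rewrite dist_fun_mx_sum; apply: memv_suml => j _; apply/memvZ/memv_span.
  by apply: map_f; rewrite mem_iota /= add0n ltn_ord.
pose As := in_tuple [seq distance_mx F e i | i <- iota 0 D.+1].
have def_B := coord_span (X := As) BM.
exists (fun n : nat => \sum_i coord As i B * (n == i :> nat)%:R).
rewrite [LHS]def_B; apply/matrixP => s t; rewrite summxE mxE.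
apply: eq_bigr => i _; rewrite mxE; congr (_ * _).
have lt_i : (i < D.+1)%N.
  by have := ltn_ord i; rewrite [X in (_ < X)%N]size_map size_iota.
have -> : As`_i = distance_mx F e i.
  by rewrite [LHS](nth_map 0%N) ?size_iota // nth_iota.
by rewrite mxE.
Qed.

Lemma mulmx_adjacencyE m (B : 'M[F]_(#|X|, m)) s t :
  (A *m B) s t = \sum_(w | e (enum_val s) w) B (enum_rank w) t.
Proof.
rewrite mxE (reindex_onto enum_rank enum_val) => [|i _]; last exact: enum_valK.
rewrite [RHS]big_mkcond /=; apply: eq_big => [w|w _].
  by rewrite enum_rankK eqxx.
by rewrite !mxE enum_rankK dist_eq1 //; case: ifP; rewrite ?mul1r ?mul0r.
Qed.

Lemma adjacency_mul_dist_fun c : A *m dist_fun_mx c =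
  dist_fun_mx (fun h => c h.-1 *+ c_ h + c h.+1 *+ b_ h).
Proof.
apply/matrixP => s t; rewrite mulmx_adjacencyE mxE -sum_nbr.
by apply: eq_bigr => w _; rewrite mxE enum_rankK.
Qed.

Lemma bose_mesner_mulA B : B \in M -> A *m B \in M.
Proof.
move=> /bose_mesnerP[c ->]; rewrite adjacency_mul_dist_fun.
by apply/bose_mesnerP; eexists.
Qed.

Lemma dist_fun_mx_inj c c' (x : X) : dist_fun_mx c = dist_fun_mx c' ->
  forall h, (h <= D)%N -> c h = c' h.
Proof.
move=> eq_c h /(exists_dist conn x)[[y z] /= dyz].
have /matrixP/(_ (enum_rank y) (enum_rank z)) := eq_c.
by rewrite !mxE !enum_rankK dyz.
Qed.

Lemma distance_mx0 : distance_mx F e 0 = 1%:M.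
Proof.
apply/matrixP => s t; rewrite !mxE dist_eq0 //.
by rewrite (inj_eq enum_val_inj).
Qed.

Lemma bose_mesner1 : 1%:M \in M.
Proof.
by rewrite -distance_mx0 memv_span //; apply: map_f; rewrite mem_iota.
Qed.

Lemma bose_mesner_tr B : B \in M -> B^T = B.
Proof.
by case/bose_mesnerP=> c ->; apply/matrixP => s t; rewrite !mxE dist_sym.
Qed.

Lemma adjacency_in_bose_mesner : A \in M.
Proof. by rewrite -[A]mulmx1 bose_mesner_mulA // bose_mesner1. Qed.

(** Obtained by comparing entries at distance [h]; up to scaling, [c] is the cosine sequence of
    [a]. *)
Lemma dist_fun_eigen_rec c a (x : X) :
  A *m dist_fun_mx c = a *: dist_fun_mx c ->
  forall h, (h <= D)%N -> c h.-1 *+ c_ h + c h.+1 *+ b_ h = a * c h.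
Proof.
move=> eigc h hD; have := adjacency_mul_dist_fun c; rewrite eigc.
have -> : a *: dist_fun_mx c = dist_fun_mx (fun h => a * c h).
  by apply/matrixP => s t; rewrite !mxE.
by move/(dist_fun_mx_inj x)/(_ h hD) => ->.
Qed.

(** The bipartite three-term recurrence, without a middle term. It expresses each distance matrix
    through [A] and the two preceding ones. *)
Lemma adjacency_mul_distance j : A *m distance_mx F e j.+1 =
  distance_mx F e j.+2 *+ c_ j.+2 + distance_mx F e j *+ b_ j.
Proof.
have -> i : distance_mx F e i = dist_fun_mx (fun h => (h == i)%:R).
  by apply/matrixP => s t; rewrite !mxE.
rewrite adjacency_mul_dist_fun; apply/matrixP => s t; rewrite !(mxE, mulmxnE).
set h := dist _ _ _; congr (_ + _).
  case: h => [|h] /=; first by rewrite !mul0rn.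
  by rewrite eqSS; case: eqP => [->|]; rewrite ?mul0rn.
by rewrite eqSS; case: eqP => [->|]; rewrite ?mul0rn.
Qed.

End BoseMesner.

(** Since [b_ h] is nonzero for [h < D], the recurrence determines [c] from [c 0]. Thus each
    eigenspace of [A] in the Bose-Mesner algebra has dimension at most one, and the diagonal entry
    detects zero. *)
Lemma dist_fun_eigen_eq0 (F : numFieldType) (c : nat -> F) a (x : X) :
  adjacency_mx F e *m dist_fun_mx c = a *: dist_fun_mx c -> c 0%N = 0 ->
  dist_fun_mx c = 0.
Proof.
move=> /(dist_fun_eigen_rec x) rec c0.
suff c_eq0 h : (h <= D)%N -> c h = 0.
  by apply/matrixP => s t; rewrite !mxE c_eq0 // dist_le_diameter.
(* The recurrence has order two, so two consecutive values are carried through the induction. *)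
suff: (h <= D)%N -> c h = 0 /\ c h.-1 = 0 by move=> ch0 /ch0[].
elim: h => [//|h IHh] lt_hD; have [ch ch1] := IHh (ltnW lt_hD); split=> //.
have /eqP := rec h (ltnW lt_hD); rewrite ch ch1 mul0rn add0r mulr0.
by rewrite mulrn_eq0 eqn0Ngt (b_gt0 x) // => /eqP.
Qed.

End IntersectionNumbers.

(** * Thin irreducible modules *)

Section TerwilligerModules.
Variables (F : fieldType) (X : finType) (e : rel X) (x : X).
Implicit Type W : {vspace 'cV[F]_#|X|}.

Local Notation D := (diameter e).
Local Notation A := (adjacency_mx F e).
Local Notation Es := (dual_idempotent F e x).

Lemma mx_imageP (n : nat) (B : 'M[F]_n) (U : {vspace 'cV[F]_n}) u :
  reflect (exists2 w, w \in U & u = B *m w) (u \in mx_image B U).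
Proof.
apply: (iffP memv_imgP) => [[w wU ->] | [w wU ->]]; exists w => //.
  by rewrite lfunE.
by rewrite lfunE.
Qed.

Lemma mx_orbitP (n : nat) (M : {vspace 'M[F]_n}) (v u : 'cV[F]_n) :
  reflect (exists2 B, B \in M & u = B *m v) (u \in mx_orbit M v).
Proof.
apply: (iffP memv_imgP) => [[B BM ->] | [B BM ->]]; exists B => //.
  by rewrite lfunE.
by rewrite lfunE.
Qed.

Lemma mx_orbit_span n (B : nat -> 'M[F]_n) (I : seq nat) (v : 'cV[F]_n) :
  mx_orbit <<[seq B i | i <- I]>> v = <<[seq B i *m v | i <- I]>>%VS.
Proof.
rewrite /mx_orbit limg_span -map_comp; congr span.
by apply: eq_map => i /=; rewrite lfunE.
Qed.

Lemma dim_le1_line (vT : vectType F) (V : {vspace vT}) u w :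
  (\dim V <= 1)%N -> u \in V -> u != 0 -> w \in V -> exists a, w = a *: u.
Proof.
move=> dimV uV u_neq0 wV; apply/vlineP; suff -> : (<[u]> = V)%VS by [].
by apply/eqP; rewrite eqEdim -memvE uV dim_vline u_neq0.
Qed.

Lemma dual_idempotent_mulE m (B : 'M[F]_(#|X|, m)) i s t :
  (Es i *m B) s t = (dist e x (enum_val s) == i)%:R * B s t.
Proof. by rewrite mul_diag_mx !mxE. Qed.

Lemma dual_idempotent_gt_diameter i : (D < i)%N -> Es i = 0.
Proof.
move=> lt_i; rewrite -[LHS]mulmx1; apply/matrixP => s t.
rewrite dual_idempotent_mulE [RHS]mxE.
case: eqP => [d_i|_]; last by rewrite mul0r.
by move: (dist_le_diameter e x (enum_val s)); rewrite d_i leqNgt lt_i.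
Qed.

(** Stability under the generators suffices. Beyond the diameter [Es i] is zero, so the condition
    may range over all [i]. *)
Lemma T_moduleP W :
  T_module e x W <->
  (forall w, w \in W -> A *m w \in W) /\
  (forall i w, w \in W -> Es i *m w \in W).
Proof.
split=> [modW | [AW EsW] B]; first split=> [w wW | i w wW].
- by apply: modW => //; apply: GenIn; rewrite mem_head.
- have [le_iD | /dual_idempotent_gt_diameter->] := leqP i D; last first.
    by rewrite mul0mx mem0v.
  apply: modW => //; apply: GenIn; rewrite inE.
  by apply/orP; right; apply: map_f; rewrite mem_iota add0n ltnS.
elim=> {B} [B B_gen | | a B _ IHB | B C _ IHB _ IHC | B C _ IHB _ IHC] w wW.
- move: B_gen; rewrite inE => /predU1P[->|/mapP[i _ ->]]; first exact: AW.
  exact: EsW.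
- by rewrite mul1mx.
- by rewrite -scalemxAl memvZ ?IHB.
- by rewrite mulmxDl memvD ?IHB ?IHC.
- by rewrite -mulmxA IHB ?IHC.
Qed.

Lemma endpoint_eq0 W r i w : endpoint e x W = r -> (i < r)%N -> (r <= D.+1)%N ->
  w \in W -> Es i *m w = 0.
Proof.
move=> endW lt_i le_r wW; have lt_iD : (i < D.+1)%N by apply: leq_trans le_r.
have lt_i' : (i < endpoint e x W)%N by rewrite endW.
have := before_find 0 lt_i'; rewrite nth_iota // add0n => /negbFE/eqP im0.
by apply/eqP; rewrite -memv0 -im0; apply/mx_imageP; exists w.
Qed.

(** The projection onto the ball of radius [i] about [x]. *)
Definition dual_below i : 'M[F]_#|X| :=
  diag_mx (\row_s (dist e x (enum_val s) <= i)%:R).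

Lemma dual_below_mulE m i (B : 'M[F]_(#|X|, m)) s t :
  (dual_below i *m B) s t = (dist e x (enum_val s) <= i)%:R * B s t.
Proof. by rewrite mul_diag_mx !mxE. Qed.

Lemma dual_below_sum i : dual_below i = \sum_(j < i.+1) Es j.
Proof.
rewrite -[LHS]mulmx1 -[RHS]mulmx1 mulmx_suml; apply/matrixP => s t.
rewrite dual_below_mulE summxE; set h := dist _ _ _.
have [le_hi | lt_ih] := leqP h i.
  rewrite (bigD1 (Ordinal (n := i.+1) le_hi)) //= big1 => [|j].
    by rewrite dual_idempotent_mulE eqxx addr0.
  rewrite -val_eqE /= dual_idempotent_mulE eq_sym -/h => /negbTE->.
  by rewrite mul0r.
rewrite mul0r big1 // => j _; rewrite dual_idempotent_mulE -/h.
by rewrite gtn_eqF ?mul0r // (leq_trans (ltn_ord j)).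
Qed.

Hypotheses (esym : symmetric e) (eirr : irreflexive e).
Hypothesis conn : connected_graph e.

Lemma dist_nbr_le y w : e y w -> (dist e x y <= (dist e x w).+1)%N.
Proof. by move=> /(dist_edge_le conn x); rewrite !(dist_sym conn esym _ x). Qed.

(** An edge leaving the ball of radius [i] joins level [i] to level [i.+1], so the part of [y]
    outside the ball comes from level [i] of [w] alone. *)
Lemma adjacency_below_split i (w : 'cV[F]_#|X|) :
  let y := A *m (dual_below i *m w) in
  y = dual_below i *m y + Es i.+1 *m A *m (Es i *m w).
Proof.
move=> y; apply/colP => s; rewrite [RHS]mxE dual_below_mulE -mulmxA.
rewrite dual_idempotent_mulE /y !mulmx_adjacencyE //.
set h := dist _ _ _; have [le_hi | lt_ih] := leqP h i.
  by rewrite ltn_eqF // mul1r mul0r addr0.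
rewrite mul0r add0r; have [h_i | neq_hi] := eqVneq h i.+1.
  rewrite mul1r; apply: eq_bigr => z esz.
  rewrite dual_below_mulE dual_idempotent_mulE enum_rankK; congr (_%:R * _).
  by have := dist_nbr_le esz; rewrite -/h h_i ltnS eqn_leq => ->; rewrite andbT.
rewrite mul0r big1 // => z esz; rewrite dual_below_mulE enum_rankK.
have := dist_nbr_le esz; rewrite -/h => le_h.
by rewrite leqNgt (_ : (i < _)%N) ?mul0r //; move: lt_ih neq_hi le_h; lia.
Qed.

Lemma dual_below_comm i j (w : 'cV[F]_#|X|) :
  Es j *m (dual_below i *m w) = dual_below i *m (Es j *m w).
Proof.
apply/colP=> s.
by rewrite !(dual_idempotent_mulE, dual_below_mulE) mulrCA.
Qed.

Lemma dual_below_dual i j (w : 'cV[F]_#|X|) : (j <= i)%N ->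
  dual_below i *m (Es j *m w) = Es j *m w.
Proof.
move=> le_ji; apply/colP=> s; rewrite dual_below_mulE dual_idempotent_mulE.
by case: eqP => [->|_]; rewrite ?mul0r ?mulr0 // le_ji mul1r.
Qed.

(* Irreducibility forces the raising map [E*_(i+1) A E*_i] to be nonzero on [W]
   unless [W] vanishes beyond level [i]; thinness then makes it surjective. *)
Lemma thin_irreducible_sub W (U : {vspace 'cV[F]_#|X|}) r v :
  irreducible_T_module e x W -> thin e x W -> endpoint e x W = r ->
  (r <= D)%N -> v \in mx_image (Es r) W -> v != 0 ->
  v \in U -> (forall u, u \in U -> A *m u \in U) -> (W <= U)%VS.
Proof.
move=> [modW _ irrW] thinW endW le_rD vEW v_neq0 vU AU.
have [AW EsW] := (T_moduleP W).1 modW.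
have belowW i w : w \in W -> dual_below i *m w \in W.
  move=> wW; rewrite dual_below_sum mulmx_suml memv_suml // => j _.
  exact: EsW.
(* Below the endpoint [W] has no component; at the endpoint [v] spans, by thinness. *)
have low j w : (j <= r)%N -> w \in W -> Es j *m w \in U.
  move=> le_jr wW; have [lt_jr | le_rj] := ltnP j r.
    by rewrite (endpoint_eq0 endW lt_jr (leqW le_rD) wW) mem0v.
  have -> : j = r by apply/eqP; rewrite eqn_leq le_jr.
  have [|a ->] := dim_le1_line (thinW r le_rD) vEW v_neq0 (w := Es r *m w).
    by apply/mx_imageP; exists w.
  exact: memvZ.
suff EsU i j w : (j <= i)%N -> w \in W -> Es j *m w \in U.
  apply/subvP=> w wW; suff -> : w = \sum_(j < D.+1) Es j *m w.
    by apply: memv_suml => j _; apply: (EsU j).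
  rewrite -mulmx_suml -dual_below_sum; apply/colP=> s.
  by rewrite dual_below_mulE dist_le_diameter mul1r.
elim: i j w => [|i IHi] j w; first by rewrite leqn0 => /eqP->; apply: low.
rewrite leq_eqVlt => /predU1P[-> wW | ]; last exact: IHi.
have [|lt_ri] := leqP i.+1 r; first by move/low; apply.
(* If the raising map vanishes on [W], the ball part of [W] is a submodule containing [v], hence all
   of [W], and level [i.+1] of [W] is zero. *)
have [zero | nz] := eqVneq (mx_image (Es i.+1 *m A *m Es i) W) 0%VS.
  suff defW : mx_image (dual_below i) W = W.
    move: wW; rewrite -{1}defW => /mx_imageP[u uW ->].
    rewrite dual_below_comm (_ : _ *m _ = 0) ?mem0v //; apply/colP=> s.
    rewrite dual_below_mulE dual_idempotent_mulE mxE.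
    by case: eqP => [->|_]; rewrite ?ltnn !mul0r ?mulr0.
  have modY : T_module e x (mx_image (dual_below i) W).
    apply/T_moduleP; split=> [u /mx_imageP[y yW ->] | j' u /mx_imageP[y yW ->]].
      rewrite adjacency_below_split (_ : Es i.+1 *m A *m (Es i *m y) = 0).
        by rewrite addr0; apply/mx_imageP; eexists; last by []; apply/AW/belowW.
      apply/eqP; rewrite mulmxA -memv0 -zero.
      by apply/mx_imageP; exists y.
    rewrite dual_below_comm; apply/mx_imageP.
    by exists (Es j' *m y) => //; apply: EsW.
  have subYW : (mx_image (dual_below i) W <= W)%VS.
    by apply/subvP=> u /mx_imageP[y yW ->]; apply: belowW.
  have [im0 | //] := irrW _ modY subYW.
  case/eqP: v_neq0; apply/eqP; rewrite -memv0 -im0.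
  have /mx_imageP[y yW def_v] := vEW; apply/mx_imageP; exists v.
    by rewrite def_v EsW.
  by rewrite def_v dual_below_dual.
have /mx_imageP[y yW def_u] := memv_pick (mx_image (Es i.+1 *m A *m Es i) W).
set u := vpick _ in def_u; have u_neq0 : u != 0 by rewrite vpick0.
have uEW : u \in mx_image (Es i.+1) W.
  by apply/mx_imageP; exists (A *m (Es i *m y)); rewrite ?AW ?EsW // !mulmxA.
(* [u] is [A *m (Es i *m y)] minus its part in the ball: the first lies in [U] by stability, the
   second by induction. *)
have uU : u \in U.
  have /= := adjacency_below_split i (Es i *m y).
  rewrite dual_below_dual // addrC => /eqP; rewrite -subr_eq => /eqP.
  have -> : Es i *m (Es i *m y) = Es i *m y.
    apply/colP=> s; rewrite !dual_idempotent_mulE.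
    by case: eqP; rewrite ?mul1r ?mul0r.
  rewrite [RHS]mulmxA -def_u => <-.
  have AyU : A *m (Es i *m y) \in U by apply/AU/IHi.
  rewrite memvB // dual_below_sum mulmx_suml memv_suml // => j' _.
  by apply: IHi; [rewrite -ltnS | apply/AW/EsW].
have [le_iD | /dual_idempotent_gt_diameter->] := leqP i.+1 D; last first.
  by rewrite mul0mx mem0v.
have [|a ->] := dim_le1_line (thinW _ le_iD) uEW u_neq0 (w := Es i.+1 *m w).
  by apply/mx_imageP; exists w.
exact: memvZ.
Qed.

End TerwilligerModules.

(** * Idempotents acting on a vector at level two *)

(* [c0], ..., [c4] are the entries of an eigenmatrix in [M] at distances 0 to 4,
   and [p2], [q2], [p3], [q3] the intersection numbers [c_2], [b_2], [c_3], [b_3];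
   the first four hypotheses are the recurrence at distances 0 to 3. *)
Lemma local_eigenvalue_identity (K : comRingType) (k a c0 c1 c2 c3 c4 : K)
    (p2 q2 p3 q3 : K) :
  k * c1 = a * c0 -> c0 + (k - 1) * c2 = a * c1 ->
  p2 * c1 + q2 * c3 = a * c2 -> p3 * c2 + q3 * c4 = a * c3 ->
  p2 + q2 = k -> p3 + q3 = k ->
  q2 * k * (k - 1) * (c0 - c4 + (q3 - 1) * (c2 - c4)) =
  a ^+ 2 * (k ^+ 2 - a ^+ 2) * c0.
Proof.
move=> r0 r1 r2 r3 s2 s3.
(* The coefficient of [c4] is [- q3], so the recurrence at distance 3 eliminates [c4]; the one at
   distance 1 then leaves [a * (c1 - c3)]. *)
have -> : c0 - c4 + (q3 - 1) * (c2 - c4) =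
    c0 + (q3 - 1 + p3) * c2 - (p3 * c2 + q3 * c4).
  by ring.
have -> : q3 - 1 + p3 = k - 1 by rewrite -s3; ring.
rewrite r3 r1.
(* The factor [q2] lets the recurrence at distance 2 eliminate [c3]; the factors [k - 1] and [k]
   then bring [c2] and [c1] down to [c0]. *)
have -> : q2 * k * (k - 1) * (a * c1 - a * c3) =
  a * k * (k - 1) * ((p2 + q2) * c1 - (p2 * c1 + q2 * c3)) by ring.
rewrite r2 s2 r0.
have -> : a * k * (k - 1) * (a * c0 - a * c2) =
  a ^+ 2 * (k ^+ 2 * c0 - k * (c0 + (k - 1) * c2)) by ring.
by rewrite r1 mulrCA r0; ring.
Qed.

(** * Hermitian norm and reality of the idempotents *)

Section Hermitian.
Variable C : numClosedFieldType.

Local Notation conjmx := (map_mx (@Num.conj C)).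

Lemma sqnorm_colE n (u : 'cV[C]_n) :
  ((conjmx u)^T *m u) 0 0 = \sum_s `|u s 0| ^+ 2.
Proof. by rewrite mxE; apply: eq_bigr => s _; rewrite !mxE mulrC -normCK. Qed.

Lemma sqnorm_col_ge0 n (u : 'cV[C]_n) : 0 <= ((conjmx u)^T *m u) 0 0.
Proof. by rewrite sqnorm_colE sumr_ge0 // => s _; rewrite exprn_ge0. Qed.

Lemma sqnorm_col_eq0 n (u : 'cV[C]_n) :
  (((conjmx u)^T *m u) 0 0 == 0) = (u == 0).
Proof.
rewrite sqnorm_colE psumr_eq0 => [|s _]; last by rewrite exprn_ge0.
apply/allP/eqP => [u0 | -> s _]; last by rewrite mxE normr0 expr0n /= eqxx.
apply/colP=> s; rewrite mxE; apply/eqP.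
by have := u0 s (mem_index_enum _); rewrite /= expf_eq0 normr_eq0.
Qed.

Variables (X : finType) (e : rel X) (p : nat -> nat -> nat -> nat).
Variable (f : X -> bool).
Hypotheses (esym : symmetric e) (eirr : irreflexive e).
Hypotheses (conn : connected_graph e) (drg : distance_regular e p).
Hypothesis f_edge : forall y z, e y z -> f y != f z.
Variable x : X.

Local Notation D := (diameter e).
Local Notation A := (adjacency_mx C e).
Local Notation M := (bose_mesner C e).
Local Notation Es := (dual_idempotent C e x).

(* The conjugate of [E] lies in the same one-dimensional eigenspace of [A] in
   [M], hence is a multiple of [E]; being idempotent, it is [E]. *)
Lemma eigen_idempotent_conj (E : 'M[C]_#|X|) a :
  a \is Num.real -> E \in M -> E != 0 -> E *m E = E -> A *m E = a *: E ->
  conjmx E = E.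
Proof.
move=> a_real EM E_neq0 EE AE; have /bose_mesnerP[c def_E] := EM.
have c0_neq0 : c 0%N != 0.
  apply: contra_neq E_neq0 => c0; rewrite def_E.
  apply: (dist_fun_eigen_eq0 esym eirr conn drg f_edge (a := a)) => //.
  by rewrite -def_E.
have AcE : A *m conjmx E = a *: conjmx E.
  have /(congr1 conjmx) := AE; rewrite map_mxM map_mxZ /= conj_Creal // => <-.
  by congr (_ *m _); apply/matrixP => s t; rewrite !mxE rmorph_nat.
(* This combination is an eigenmatrix for [a] with zero diagonal. *)
have cE : c 0%N *: conjmx E - (c 0%N)^* *: E = 0.
  have -> : c 0%N *: conjmx E - (c 0%N)^* *: E =
            dist_fun_mx e (fun h => c 0%N * (c h)^* - (c 0%N)^* * c h).
    by rewrite def_E; apply/matrixP => s t; rewrite !mxE.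
  apply: (dist_fun_eigen_eq0 esym eirr conn drg f_edge (a := a)) => //.
    have <- : c 0%N *: conjmx E - (c 0%N)^* *: E =
            dist_fun_mx e (fun h => c 0%N * (c h)^* - (c 0%N)^* * c h).
      by rewrite def_E; apply/matrixP => s t; rewrite !mxE.
    rewrite mulmxBr -!scalemxAr AE AcE scalerBr !scalerA.
    by congr (_ *: _ - _ *: _); rewrite mulrC.
  by rewrite mulrC subrr.
set l := (c 0%N)^* / c 0%N.
have conjE : conjmx E = l *: E.
  move/eqP: cE; rewrite subr_eq0 => /eqP/(congr1 (fun B => (c 0%N)^-1 *: B)).
  by rewrite !scalerA mulVf // scale1r mulrC => ->.
have l_neq0 : l != 0 by rewrite mulf_neq0 ?invr_eq0 ?conjC_eq0.
(* Both sides are the conjugate of [E], the right one written as its own square; cancelling [l]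
   gives the claim. *)
clearbody l; have : l *: E = (l * l) *: E.
  rewrite -conjE -[in LHS]EE map_mxM conjE -scalemxAl -scalemxAr EE.
  by rewrite scalerA.
move=> /(congr1 (fun B => l^-1 *: B)); rewrite !scalerA mulrA mulVf //.
by rewrite mul1r scale1r -conjE.
Qed.

(** [c 0] is the diagonal entry at [x] of [E *m E], a sum of squared moduli because [E] is real and
    symmetric. It is nonzero by [dist_fun_eigen_eq0]. *)
Lemma dist_fun_idempotent_gt0 c a : let E := dist_fun_mx e c in
  a \is Num.real -> E != 0 -> E *m E = E -> A *m E = a *: E -> 0 < c 0%N.
Proof.
move=> E a_real E_neq0 EE AE.
have EM : E \in M by apply/bose_mesnerP; exists c.
have conjE := eigen_idempotent_conj a_real EM E_neq0 EE AE.
rewrite lt0r; apply/andP; split.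
  apply: contra_neq E_neq0 => c0.
  exact: (dist_fun_eigen_eq0 esym eirr conn drg f_edge x AE).
have /matrixP/(_ (enum_rank x) (enum_rank x)) := EE.
rewrite [in RHS]mxE dist_refl => <-; rewrite mxE sumr_ge0 // => s _.
have -> : E (enum_rank x) s = (E s (enum_rank x))^*.
  by rewrite -[in LHS]conjE !mxE dist_sym.
by rewrite mulrC -normCK exprn_ge0.
Qed.

Lemma level2_dist_fun c (v : 'cV[C]_#|X|) eta :
  Es 2 *m v = v -> \sum_s v s 0 = 0 ->
  Es 2 *m (distance_mx C e 2 *m v) = eta *: v ->
  Es 2 *m (dist_fun_mx e c *m v) =
  (c 0%N - c 4%N + eta * (c 2%N - c 4%N)) *: v.
Proof.
move=> Ev sum_v A2v; apply/colP=> s; rewrite dual_idempotent_mulE.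
have v0 t : dist e x (enum_val t) != 2%N -> v t 0 = 0.
  by move=> ne2; rewrite -Ev dual_idempotent_mulE (negbTE ne2) mul0r.
rewrite [RHS]mxE.
have [ds|ne2] := eqVneq (dist e x (enum_val s)) 2%N; last first.
  by rewrite v0 // mul0r mulr0.
have A2v_s : (distance_mx C e 2 *m v) s 0 = eta * v s 0.
  by have /colP/(_ s) := A2v; rewrite dual_idempotent_mulE ds mul1r [RHS]mxE.
rewrite mul1r [RHS]mulrDl (mulrC eta) -mulrA -A2v_s.
(* Between vertices of level 2 the matrix agrees with a combination of the identity, the second
   distance matrix and the all-ones matrix; the last kills [v] because its entries sum to zero. *)
transitivity (\sum_t ((c 0%N - c 4%N) * ((s == t)%:R * v t 0) +
   (c 2%N - c 4%N) * (distance_mx C e 2 s t * v t 0) + c 4%N * v t 0)).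
  rewrite mxE; apply: eq_bigr => t _; rewrite !mxE.
  have [dt|/v0->] := eqVneq (dist e x (enum_val t)) 2%N; last first.
    by rewrite !mulr0 !addr0.
  rewrite -(inj_eq enum_val_inj) -(dist_eq0 conn).
  set h := dist _ _ _.
  have le4 : (h <= 4)%N.
    have := dist_triangle conn (enum_val s) x (enum_val t).
    by rewrite dt (dist_sym conn esym _ x) ds.
  have evenh : ~~ odd h.
    have := odd_dist conn f_edge (enum_val s) (enum_val t).
    have := odd_dist conn f_edge x (enum_val t).
    have := odd_dist conn f_edge x (enum_val s); rewrite ds dt -/h.
    by case: (f x) (f (enum_val s)) (f (enum_val t)) => [] [] [] //= _ _ ->.
  by move: h le4 evenh => [|[|[|[|[|]]]]] //= _ _; ring.
rewrite !big_split /= -!mulr_sumr sum_v mulr0 addr0; congr (_ * _ + _ * _).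
  rewrite (bigD1 s) //= eqxx mul1r big1 ?addr0 // => t.
  by rewrite eq_sym => /negbTE->; rewrite mul0r.
by rewrite [RHS]mxE.
Qed.

End Hermitian.

(** Applied twice with [g] left multiplication by [A]: to the matrices [E i] and to the vectors
    [E i *m v]. *)
Lemma eigenvectors_free (F : fieldType) (vT : vectType F)
    (g : {linear vT -> vT}) (t : nat -> F) (u : nat -> vT) (I : seq nat) :
  uniq I -> {in I &, injective t} ->
  (forall i, i \in I -> g (u i) = t i *: u i) ->
  (forall i, i \in I -> u i != 0) -> free (map u I).
Proof.
elim: I => [|i I IHI] /=; first by rewrite /free span_nil dimv0.
move=> /andP[i_notin uniqI] t_inj gu u_neq0.
have sub j : j \in I -> j \in i :: I.
  by move=> jI; rewrite inE jI orbT.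
have freeI : free (map u I).
  apply: IHI => // [j l jI lI | j /sub/gu // | j /sub/u_neq0 //].
  exact: t_inj (sub _ jI) (sub _ lI).
rewrite free_cons freeI andbT; apply/negP => ui_span.
have i_in : i \in i :: I by rewrite mem_head.
pose Us := in_tuple (map u I); have def_ui := coord_span (X := Us) ui_span.
set n := size _ in Us def_ui; pose c (j : 'I_n) : F := coord Us j (u i).
have lt_j (j : 'I_n) : (j < size I)%N by rewrite -(size_map u) ltn_ord.
have nthU (j : 'I_n) : Us`_j = u (nth 0%N I j) by rewrite [LHS](nth_map 0%N).
have gU (j : 'I_n) : g Us`_j = t (nth 0%N I j) *: Us`_j.
  by rewrite nthU gu // sub // mem_nth.
(* Result of applying [g] minus [t i] to the expression of [u i] in the other vectors. *)
have sum0 : \sum_j (c j * (t (nth 0%N I j) - t i)) *: Us`_j = 0.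
  have := gu i i_in; rewrite [in LHS]def_ui linear_sum /=.
  rewrite [in RHS]def_ui scaler_sumr => /eqP.
  rewrite -subr_eq0 -sumrB => /eqP eq0.
  rewrite -[RHS]eq0; apply: eq_bigr => j _.
  rewrite -/(c j) linearZ /= gU !scalerA mulrBr scalerBl.
  by rewrite [t i * c j]mulrC.
have c0 j : c j = 0.
  have freeUs : free Us := freeI.
  have /eqP := (freeP freeUs) (fun j => c j * (t (nth 0%N I j) - t i)) sum0 j.
  rewrite mulf_eq0 subr_eq0 => /orP[/eqP // | /eqP t_eq].
  have jI : nth 0%N I j \in I by rewrite mem_nth.
  by rewrite -(t_inj _ _ (sub _ jI) i_in t_eq) jI in i_notin.
case/eqP: (u_neq0 i i_in); rewrite def_ui big1 // => j _.
by rewrite -/(c j) c0 scale0r.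
Qed.

(** * Eigenvalues of [A], and the norm of [E *m v] for [v] on level two *)

Section EndpointTwo.
Variables (C : numClosedFieldType) (X : finType) (e : rel X).
Variables (p : nat -> nat -> nat -> nat) (f : X -> bool) (k : nat) (x : X).
Hypotheses (esym : symmetric e) (eirr : irreflexive e).
Hypotheses (conn : connected_graph e) (drg : distance_regular e p).
Hypothesis f_edge : forall y z, e y z -> f y != f z.
Hypothesis val_k : valency e k.

Local Notation D := (diameter e).
Local Notation A := (adjacency_mx C e).
Local Notation M := (bose_mesner C e).
Local Notation Es := (dual_idempotent C e x).
Implicit Type W : {vspace 'cV[C]_#|X|}.

(** Up to the diameter [p j.+2 1 j.+1] is nonzero, so the recurrence can be solved for the next
    distance matrix; beyond it these matrices are zero. *)
Lemma T_module_bose_mesner W B w :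
  T_module e x W -> B \in M -> w \in W -> B *m w \in W.
Proof.
move=> /T_moduleP[AW _] /bose_mesnerP[c ->] wW.
rewrite dist_fun_mx_sum mulmx_suml; apply: memv_suml => j _.
rewrite -scalemxAl memvZ //; move: (j : nat) => {}j.
suff: distance_mx C e j *m w \in W /\ distance_mx C e j.+1 *m w \in W by case.
elim: j => [|j [IH0 IH1]].
  by rewrite distance_mx0 // mul1mx; split=> //; apply: AW.
split=> //; have [le_jD|lt_Dj] := leqP j.+2 D; last first.
  suff -> : distance_mx C e j.+2 = 0 by rewrite mul0mx mem0v.
  apply/matrixP => s t; rewrite !mxE ltn_eqF //.
  by apply: leq_ltn_trans lt_Dj; apply: dist_le_diameter.
have c_neq0 : (p j.+2 1 j.+1)%:R != 0 :> C.
  by rewrite pnatr_eq0 -lt0n (c_gt0 eirr conn drg x).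
suff -> : distance_mx C e j.+2 = (p j.+2 1 j.+1)%:R^-1 *:
    (A *m distance_mx C e j.+1 - distance_mx C e j *+ b_ p j).
  rewrite -scalemxAl memvZ // mulmxBl -mulmxA memvB ?AW //.
  by rewrite -scaler_nat -scalemxAl memvZ.
rewrite (adjacency_mul_distance esym eirr conn drg f_edge) addrK.
by rewrite -scaler_nat scalerA mulVf ?scale1r.
Qed.

Lemma adjacency_tr : A^T = A.
Proof.
apply: (bose_mesner_tr esym conn).
exact: (adjacency_in_bose_mesner esym eirr conn drg f_edge).
Qed.

(** [eigenvalue] refers to row vectors; the symmetry of [A] transfers it to columns. *)
Lemma eigenvalue_colP a :
  reflect (exists2 u : 'cV[C]_#|X|, A *m u = a *: u & u != 0) (eigenvalue A a).
Proof.
apply: (iffP eigenvalueP) => [[u uA u0] | [u Au u0]]; exists u^T.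
- by rewrite -[LHS]trmxK trmx_mul trmxK adjacency_tr uA linearZ.
- by rewrite trmx_eq0.
- by rewrite -[LHS]trmxK trmx_mul trmxK adjacency_tr Au linearZ.
by rewrite trmx_eq0.
Qed.

Lemma eigenvalue_valency : eigenvalue A k%:R.
Proof.
apply/eigenvalue_colP; exists (const_mx 1).
  apply/colP=> s; rewrite mulmx_adjacencyE // !mxE mulr1 -(val_k (enum_val s)).
  rewrite -sum1_card natr_sum [RHS]big_mkcond [LHS]big_mkcond /=.
  by apply: eq_bigr => w _; rewrite inE mxE.
apply/eqP=> /colP/(_ (enum_rank x)); rewrite !mxE => /eqP.
by rewrite oner_eq0.
Qed.

(** The sign of an eigenvector is changed on one colour class. *)
Lemma eigenvalue_opp a : eigenvalue A a -> eigenvalue A (- a).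
Proof.
case/eigenvalue_colP=> u Au u_neq0; apply/eigenvalue_colP.
exists (\col_s ((-1) ^+ f (enum_val s) * u s 0)).
  apply/colP=> s; have /colP/(_ s) := Au.
  rewrite !mulmx_adjacencyE // !mxE => Au_s.
  rewrite mulNr mulrCA -Au_s big_distrr /= -sumrN; apply: eq_bigr => w esw.
  rewrite mxE enum_rankK; move: (f_edge esw).
  by case: (f _) (f w) => [] [] //= _; rewrite expr0 expr1 !mulN1r !mul1r ?opprK.
apply: contra_neq u_neq0 => u0; apply/colP=> s.
have /colP/(_ s)/eqP := u0; rewrite !mxE mulf_eq0 signr_eq0 /=.
by move/eqP.
Qed.


Hypotheses (D_ge4 : (4 <= D)%N) (k_gt1 : (1 < k)%N).

Section LevelTwoVector.
Variable v : 'cV[C]_#|X|.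
Hypotheses (Ev : Es 2 *m v = v) (sum_v : \sum_s v s 0 = 0).
Hypothesis A2v :
  Es 2 *m (distance_mx C e 2 *m v) = ((b_ p 3)%:R - 1) *: v.
Hypothesis v_neq0 : v != 0.

Variables (E : 'M[C]_#|X|) (a : C).
Hypotheses (a_real : a \is Num.real) (EM : E \in M) (E_neq0 : E != 0).
Hypotheses (EE : E *m E = E) (AE : A *m E = a *: E).

(* [E*_2 E v = l v] with [l] a positive multiple of [a^2 (k^2 - a^2)], and
   [l] is the quotient of [|E v|^2] by [|v|^2]. *)
Lemma eigen_idempotent_level2 :
  0 <= a ^+ 2 * (k%:R ^+ 2 - a ^+ 2) /\
  (E *m v == 0) = (a ^+ 2 * (k%:R ^+ 2 - a ^+ 2) == 0).
Proof.
have [c def_E] := bose_mesnerP _ _ EM.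
have c0_gt0 : 0 < c 0%N.
  apply: (dist_fun_idempotent_gt0 esym eirr conn drg f_edge x (a := a)) => //;
    by rewrite -?def_E.
have rec := dist_fun_eigen_rec esym eirr conn drg f_edge x (c := c) (a := a).
rewrite -def_E in rec; have {}rec := rec AE.
have kE h : (h <= D)%N -> (p h 1 h.-1)%:R + (b_ p h)%:R = k%:R :> C.
  by move=> le_hD; rewrite -natrD (c_add_b esym eirr conn drg f_edge x val_k).
have b2_gt0 : 0 < (b_ p 2)%:R :> C.
  by rewrite ltr0n (b_gt0 esym eirr conn drg x) // (leq_trans _ D_ge4).
set l := c 0%N - c 4%N + ((b_ p 3)%:R - 1) * (c 2%N - c 4%N).
have def_l : (b_ p 2)%:R * k%:R * (k%:R - 1) * l =
    a ^+ 2 * (k%:R ^+ 2 - a ^+ 2) * c 0%N.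
  have leD i : (i <= 3)%N -> (i <= D)%N.
    by move=> le_i; apply: leq_trans D_ge4; apply: leqW.
  apply: (local_eigenvalue_identity (c1 := c 1%N) (c3 := c 3%N)
            (p2 := (p 2 1 1)%:R) (p3 := (p 3 1 2)%:R)).
  - have := rec 0 isT; rewrite (c0_eq0 eirr conn drg x).
    rewrite (b0_eq esym eirr conn drg f_edge x val_k) add0r => <-.
    by rewrite mulr_natl.
  - have := rec 1 (leD 1 isT); rewrite (c1_eq1 eirr conn drg x) ?leD // => <-.
    rewrite -[in k%:R - 1](kE 1) ?leD // (c1_eq1 eirr conn drg x) ?leD //.
    by rewrite [1%:R + _]addrC addrK mulr_natl.
  - by rewrite !mulr_natl -(rec 2) ?leD.
  - by rewrite !mulr_natl -(rec 3) ?leD.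
  - by rewrite (kE 2) ?leD.
  by rewrite (kE 3) ?leD.
have s_gt0 : 0 < (b_ p 2)%:R * k%:R * (k%:R - 1) :> C.
  by rewrite !mulr_gt0 // ?subr_gt0 ?ltr1n // ltr0n ltnW.
(* As [E] is a Hermitian idempotent, the squared norm pairs [v] with [E *m v]; since [v] lies on
   level 2, only [Es 2 *m (E *m v) = l *: v] contributes. *)
have Ev_sq : ((map_mx Num.conj (E *m v))^T *m (E *m v)) 0 0 =
             l * ((map_mx Num.conj v)^T *m v) 0 0.
  have conjE := eigen_idempotent_conj esym eirr conn drg f_edge x a_real EM
    E_neq0 EE AE.
  rewrite map_mxM trmx_mul conjE (bose_mesner_tr esym conn EM).
  rewrite -mulmxA (mulmxA E) EE.
  have EsE : (map_mx Num.conj (Es 2))^T = Es 2.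
    rewrite map_diag_mx tr_diag_mx; congr diag_mx; apply/rowP => s.
    by rewrite !mxE rmorph_nat.
  have {1}-> : (map_mx Num.conj v)^T = (map_mx Num.conj v)^T *m Es 2.
    by rewrite -EsE -trmx_mul -map_mxM Ev.
  rewrite -mulmxA {1}def_E.
  rewrite (level2_dist_fun esym conn f_edge c Ev sum_v A2v) -/l.
  by rewrite -scalemxAr [LHS]mxE.
have v_sq_gt0 : 0 < ((map_mx Num.conj v)^T *m v) 0 0.
  by rewrite lt0r sqnorm_col_eq0 v_neq0 sqnorm_col_ge0.
have l_ge0 : 0 <= l by rewrite -(pmulr_lge0 _ v_sq_gt0) -Ev_sq sqnorm_col_ge0.
(* By [def_l], [l] and the stated product differ by positive factors, so they agree in sign and in
   vanishing. *)
split; first by rewrite -(pmulr_lge0 _ c0_gt0) -def_l pmulr_rge0.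
rewrite -sqnorm_col_eq0 Ev_sq mulf_eq0 (gt_eqF v_sq_gt0) orbF.
rewrite -[RHS](mulIr_eq0 _ (mulIf (lt0r_neq0 c0_gt0))) -def_l mulf_eq0.
by rewrite (gt_eqF s_gt0).
Qed.

End LevelTwoVector.
End EndpointTwo.

(** * Eigenvalues and the basis *)

Section MainProof.
Variables (C : numClosedFieldType) (X : finType) (e : rel X).
Variables (p : nat -> nat -> nat -> nat) (f : X -> bool) (k : nat) (x : X).
Hypotheses (esym : symmetric e) (eirr : irreflexive e).
Hypotheses (conn : connected_graph e) (drg : distance_regular e p).
Hypothesis f_edge : forall y z, e y z -> f y != f z.
Hypothesis val_k : valency e k.

Local Notation D := (diameter e).
Local Notation d := D./2.
Local Notation A := (adjacency_mx C e).
Local Notation M := (bose_mesner C e).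
Local Notation Es := (dual_idempotent C e x).

Section Spectrum.
Variable t : nat -> C.
Hypothesis t_lt : forall i j, (i < j <= D)%N -> t j < t i.
Hypothesis t_eigen : forall a,
  eigenvalue A a <-> exists2 i, (i <= D)%N & a = t i.

Lemma spectrum_inj i j : (i <= D)%N -> (j <= D)%N -> t i = t j -> i = j.
Proof.
move=> le_iD le_jD eq_t; case: (ltngtP i j) => // lt_ij.
  by have := @t_lt i j; rewrite lt_ij le_jD eq_t ltxx => /(_ isT).
by have := @t_lt j i; rewrite lt_ij le_iD eq_t ltxx => /(_ isT).
Qed.

(** The spectrum is closed under negation, so [t j] and [- t (D - j)] both enumerate it in strictly
    decreasing order, and such an enumeration is unique. *)
Lemma spectrum_opp i : (i <= D)%N -> t (D - i) = - t i.
Proof.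
move=> le_iD; pose t' j := - t (D - j)%N.
have t'_lt a b : (a < b <= D)%N -> t' b < t' a.
  by move=> ab; rewrite ltrN2 t_lt //; lia.
have sorted_mk (g : nat -> C) : (forall a b, (a < b <= D)%N -> g b < g a) ->
    sorted >%R (mkseq g D.+1).
  move=> g_lt; apply/(sortedP 0) => j; rewrite size_mkseq => lt_jD.
  by rewrite !nth_mkseq ?(ltnW lt_jD) //; apply: g_lt; rewrite ltnSn.
have mem_mk (g : nat -> C) a :
    reflect (exists2 j, (j <= D)%N & a = g j) (a \in mkseq g D.+1).
  apply: (iffP mapP) => -[j]; rewrite ?mem_iota ?add0n => lj ->;
    by exists j; rewrite ?mem_iota.
have eq_tt' : mkseq t D.+1 = mkseq t' D.+1.
  apply: (irr_sorted_eq (leT := >%R)) (sorted_mk _ t_lt) (sorted_mk _ t'_lt) _.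
  - by move=> b a c /= ab bc; apply: lt_trans ab.
  - by move=> a /=; rewrite ltxx.
  move=> a; apply/mem_mk/mem_mk => [/t_eigen | [j le_jD ->]].
    move/(eigenvalue_opp esym eirr conn drg f_edge)/t_eigen => [j le_jD aE].
    by exists (D - j)%N; rewrite ?leq_subr // /t' subKn // -aE opprK.
  apply/t_eigen/(eigenvalue_opp esym eirr conn drg f_edge)/t_eigen.
  by exists (D - j)%N; rewrite ?leq_subr.
have := congr1 (fun s => nth 0 s i) eq_tt'.
by rewrite !nth_mkseq // /t' => ->; rewrite opprK.
Qed.

(** For even [D], [D - d = d], so [t d] is its own negative. *)
Lemma spectrum_mid : ~~ odd D -> t d = 0.
Proof.
move=> evenD; have le_d : (d <= D)%N by lia.
have := spectrum_opp le_d; rewrite (_ : D - d = d)%N; last by move: evenD; lia.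
by move/eqP; rewrite -addr_eq0 -mulr2n mulrn_eq0 => /eqP.
Qed.


Hypotheses (D_even : ~~ odd D) (D_ge4 : (4 <= D)%N) (k_gt1 : (1 < k)%N).
Hypothesis t_real : forall i, t i \is Num.real.
Variable E : nat -> 'M[C]_#|X|.
Hypothesis E_in : forall i, (i <= D)%N -> E i \in M.
Hypothesis E_neq0 : forall i, (i <= D)%N -> E i != 0.
Hypothesis E_idem : forall i, (i <= D)%N -> E i *m E i = E i.
Hypothesis E_eigen : forall i, (i <= D)%N -> A *m E i = t i *: E i.

(** A dimension count: the [D.+1] matrices [E i] are independent, having distinct eigenvalues, and
    the algebra is spanned by [D.+1] matrices. *)
Lemma bose_mesner_idempotents :
  M = <<[seq E i | i <- iota 0 D.+1]>>%VS.
Proof.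
apply/eqP; rewrite eq_sym eqEdim; apply/andP; split.
  apply/span_subvP => B; case/(@mapP _ _ E) => i.
  rewrite mem_iota add0n ltnS => le_iD ->.
  exact: E_in.
have freeE : free [seq E i | i <- iota 0 D.+1].
  apply: (eigenvectors_free (g := mulmx A) (t := t)); first exact: iota_uniq.
  - by move=> i j; rewrite !mem_iota !add0n !ltnS; apply: spectrum_inj.
  - by move=> i; rewrite mem_iota add0n ltnS => /E_eigen.
  by move=> i; rewrite mem_iota add0n ltnS => /E_neq0.
rewrite (eqP freeE) size_map size_iota.
by apply: leq_trans (dim_span _) _; rewrite size_map size_iota.
Qed.

Variables (W : {vspace 'cV[C]_#|X|}) (v : 'cV[C]_#|X|).
Hypotheses (irrW : irreducible_T_module e x W) (thinW : thin e x W).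
Hypothesis endW : endpoint e x W = 2%N.
Hypothesis locW : local_eigenvalue e x W ((b_ p 3)%:R - 1).
Hypotheses (vEW : v \in mx_image (Es 2) W) (v_neq0 : v != 0).

Let modW : T_module e x W. Proof. by case: irrW. Qed.

Let level2 : Es 2 *m v = v.
Proof.
have /mx_imageP[w _ ->] := vEW; apply/colP=> s.
by rewrite !dual_idempotent_mulE; case: eqP; rewrite ?mul1r ?mul0r.
Qed.

Let vW : v \in W.
Proof.
have /mx_imageP[w wW ->] := vEW; have /T_moduleP[_ EsW] := modW.
exact: EsW.
Qed.

(* This sum is the [x]-entry of [A_2 v], and [E*_0 W = 0]. *)
Let sum_v : \sum_s v s 0 = 0.
Proof.
have A2vW : distance_mx C e 2 *m v \in W.
  apply: (T_module_bose_mesner esym eirr conn drg f_edge modW) => //.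
  apply/memv_span/map_f; rewrite mem_iota add0n ltnS.
  by apply: leq_trans D_ge4.
have /colP/(_ (enum_rank x)) : Es 0 *m (distance_mx C e 2 *m v) = 0.
  by apply: (endpoint_eq0 endW _ _ A2vW) => //; lia.
rewrite dual_idempotent_mulE enum_rankK dist_refl mul1r [RHS]mxE => A2v_x.
rewrite -[RHS]A2v_x [RHS]mxE.
apply: eq_bigr => s _; rewrite mxE enum_rankK.
rewrite -[in LHS]level2 dual_idempotent_mulE.
by case: eqP; rewrite ?mul1r ?mul0r.
Qed.

Let E_v_eq0 i : (i <= D)%N ->
  0 <= t i ^+ 2 * (k%:R ^+ 2 - t i ^+ 2) /\
  (E i *m v == 0) = (t i ^+ 2 * (k%:R ^+ 2 - t i ^+ 2) == 0).
Proof.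
move=> le_iD.
apply: (eigen_idempotent_level2 esym eirr conn drg f_edge val_k (x := x)) => //.
- rewrite -(locW vEW) -!mulmxA; congr (_ *m (_ *m _)).
  by rewrite level2.
- exact: E_in.
- exact: E_neq0.
- exact: E_idem.
exact: E_eigen.
Qed.

(** [k] is an eigenvalue, by the constant vector. If [t 0] exceeded it, the quantity shown
    nonnegative in [E_v_eq0] would be negative at [i = 0]. *)
Lemma spectrum_top : t 0 = k%:R.
Proof.
have /t_eigen[i le_iD kE] :=
  eigenvalue_valency C x esym eirr conn drg f_edge val_k.
have [i0|i_gt0] := posnP i; first by rewrite kE i0.
have lt_k : k%:R < t 0 by rewrite kE t_lt // i_gt0.
have k_ge0 : 0 <= k%:R :> C by rewrite ler0n.
have t0_gt0 := le_lt_trans k_ge0 lt_k.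
have [] := E_v_eq0 (leq0n D); rewrite pmulr_rge0 ?exprn_gt0 // subr_ge0.
rewrite ler_pXn2r ?nnegrE // ?(ltW t0_gt0) // => /(lt_le_trans lt_k).
by rewrite ltxx.
Qed.

(** The factor in [E_v_eq0] vanishes at [k], 0 and [- k], which are [t 0], [t d] and [t D];
    injectivity of [t] turns this into a condition on [i]. *)
Lemma idempotent_vector_eq0 i : (i <= D)%N ->
  (E i *m v == 0) = [|| i == 0, i == d | i == D]%N.
Proof.
move=> le_iD; have le_dD : (d <= D)%N by lia.
have tE j : (j <= D)%N -> (t i == t j) = (i == j).
  by move=> le_jD; apply/eqP/eqP => [/spectrum_inj|->//]; apply.
have tD : t D = - k%:R.
  by rewrite -[in LHS](subn0 D) spectrum_opp // spectrum_top.
have [_ ->] := E_v_eq0 le_iD; rewrite mulf_eq0 expf_eq0 /= subr_eq0.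
rewrite [_ == t i ^+ 2]eq_sym eqf_sqr -tD -spectrum_top !tE //.
by rewrite -(spectrum_mid D_even) tE // orbCA.
Qed.

(** The orbit contains [v] and is stable under [A], so [thin_irreducible_sub] puts [W] inside it;
    conversely a module is stable under [M]. *)
Lemma thin_module_orbit : W = mx_orbit M v.
Proof.
have sub_orbit B : B \in M -> B *m v \in mx_orbit M v.
  by move=> BM; apply/mx_orbitP; exists B.
apply/eqP; rewrite eqEsubv; apply/andP; split; last first.
  apply/subvP=> u /mx_orbitP[B BM ->].
  exact: (T_module_bose_mesner esym eirr conn drg f_edge modW).
apply: (thin_irreducible_sub esym eirr conn irrW thinW endW _ vEW v_neq0).
- by apply: leq_trans D_ge4.
- by rewrite -[v in v \in _]mul1mx sub_orbit ?bose_mesner1.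
move=> u /mx_orbitP[B BM ->]; rewrite mulmxA sub_orbit //.
exact: (bose_mesner_mulA esym eirr conn drg f_edge).
Qed.

(** The listed vectors are nonzero eigenvectors of [A] for distinct eigenvalues, hence free. They
    span because [W] is the orbit of [v] and the [E i] span [M], the omitted vectors being zero. *)
Lemma idempotent_basis :
  basis_of W [seq E i *m v | i <- iota 1 D.-1 & i != d].
Proof.
have inI i : i \in [seq i <- iota 1 D.-1 | i != d] ->
    (i <= D)%N /\ E i *m v != 0.
  rewrite mem_filter mem_iota => /and3P[ne_d ge1 lt_D].
  have le_iD : (i <= D)%N by lia.
  by split=> //; rewrite idempotent_vector_eq0 //; lia.
rewrite /basis_of (eigenvectors_free (g := mulmx A) (t := t)).
- rewrite andbT thin_module_orbit eqEsubv; apply/andP; split.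
    apply/span_subvP=> u.
    case/(@mapP _ _ (fun i => E i *m v)) => i /inI[le_iD _] ->.
    by apply/mx_orbitP; exists (E i); rewrite ?E_in.
  rewrite bose_mesner_idempotents mx_orbit_span.
  apply/span_subvP=> u; case/(@mapP _ _ (fun i => E i *m v)) => i.
  rewrite mem_iota add0n ltnS => le_iD ->.
  have [-> | Ev_neq0] := eqVneq (E i *m v) 0; first exact: mem0v.
  apply/memv_span/(map_f (fun i => E i *m v)).
  by move: Ev_neq0; rewrite idempotent_vector_eq0 // mem_filter mem_iota; lia.
- exact/filter_uniq/iota_uniq.
- by move=> i j /inI[le_iD _] /inI[le_jD _]; apply: spectrum_inj.
- by move=> i /inI[le_iD _]; rewrite /= mulmxA E_eigen // scalemxAl.
by move=> i /inI[].
Qed.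

End Spectrum.
End MainProof.

(** * Specialization to the complex numbers and the given local eigenvalue *)

Local Open Scope complex_scope.
Unset Implicit Arguments.

Theorem theorem14p1 (R : realType) (X : finType) (e : rel X)
  (p : nat -> nat -> nat -> nat) (D d k : nat)
  (theta : nat -> R) (E : nat -> 'M[R[i]]_#|X|)
  (x : X) (W : {vspace 'cV[R[i]]_#|X|}) (v : 'cV[R[i]]_#|X|) :
  symmetric e -> irreflexive e -> connected_graph e ->
  distance_regular e p -> bipartite e ->
  D = diameter e -> ~~ odd D -> (4 <= D)%N -> d = D./2 ->
  valency e k -> (3 <= k)%N ->
  ordered_eigenvalues (fun r : R => r%:C) (adjacency_mx R[i] e) D theta ->
  (forall i, (i <= D)%N -> primitive_idempotent_for e (theta i)%:C (E i)) ->
  irreducible_T_module e x W -> thin e x W -> endpoint e x W = 2%N ->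
  local_eigenvalue e x W
    (- 1 - (b_ p 2)%:R * (b_ p 3)%:R / ((theta d)%:C ^+ 2 - (b_ p 2)%:R)) ->
  v \in mx_image (dual_idempotent R[i] e x 2) W -> v != 0 ->
  [/\ W = mx_orbit (bose_mesner R[i] e) v,
      basis_of W [seq E i *m v | i <- iota 1 D.-1 & i != d],
      E 0%N *m v = 0,
      E d *m v = 0 &
      E D *m v = 0].
Proof.
move=> esym eirr conn drg [f f_edge] -> D_even D_ge4 -> val_k k_ge3.
move=> [theta_lt theta_eigen] E_prim irrW thinW endW locW vEW v_neq0.
pose t i : R[i] := (theta i)%:C.
have t_lt i j : (i < j <= diameter e)%N -> t j < t i.
  by move=> /theta_lt; rewrite ltcR.
have t_real i : t i \is Num.real by apply/complex_realP; exists (theta i).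
have E_in i : (i <= diameter e)%N -> E i \in bose_mesner R[i] e.
  by case/E_prim=> -[].
have E_neq0 i : (i <= diameter e)%N -> E i != 0 by case/E_prim=> -[].
have E_idem i : (i <= diameter e)%N -> E i *m E i = E i by case/E_prim=> -[].
have E_eigen i : (i <= diameter e)%N -> adjacency_mx R[i] e *m E i = t i *: E i.
  by case/E_prim.
have b2_neq0 : (b_ p 2)%:R != 0 :> R[i].
  rewrite pnatr_eq0 -lt0n (b_gt0 esym eirr conn drg x) //.
  by rewrite (leq_trans _ D_ge4).
(* At [theta d = 0] the denominator is minus [b_ p 2], which is nonzero and cancels. *)
have {}locW : local_eigenvalue e x W ((b_ p 3)%:R - 1 : R[i]).
  have := spectrum_mid esym eirr conn drg f_edge t_lt theta_eigen D_even.
  rewrite /t => t_d; move: locW; rewrite t_d expr0n /= sub0r invrN mulrN opprK.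
  by rewrite mulrAC mulfV // mul1r addrC.
have k_gt1 : (1 < k)%N by apply: leq_trans k_ge3.
have Ev0 i (le_iD : (i <= diameter e)%N) := idempotent_vector_eq0 esym eirr conn
  drg f_edge val_k t_lt theta_eigen D_even D_ge4 k_gt1 t_real E_in E_neq0 E_idem
  E_eigen irrW endW locW vEW v_neq0 le_iD.
split.
- exact: (thin_module_orbit esym eirr conn drg f_edge D_ge4 irrW thinW endW
    vEW v_neq0).
- exact: (idempotent_basis esym eirr conn drg f_edge val_k t_lt theta_eigen
    D_even D_ge4 k_gt1 t_real E_in E_neq0 E_idem E_eigen irrW thinW endW locW
    vEW v_neq0).
- by apply/eqP; rewrite Ev0.
- by apply/eqP; rewrite Ev0 ?eqxx ?orbT //; lia.
by apply/eqP; rewrite Ev0 ?eqxx ?orbT.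
Qed.
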